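(* Let $k_1,\dots,k_n$ be $n$ (independent) samples from a Conway-Maxwell-Binomial distribution with parameters $0\le p\le 1$ and $-\infty\le\nu\le\infty$, each with respect to a common $m$. Put $$S_1=\sum_{i=1}^n k_i,\qquad S_2=\sum_{i=1}^n\log[k_i!(m-k_i)!].$$ Then the likelihood satisfies $$p(k_1,\dots,k_n\mid p,\nu)\;\propto\; e^{S_1\log(p/(1-p))-\nu S_2},$$ where $\propto$ means equality up to a factor that is constant in the data $k_1,\dots,k_n$ (it may depend on $p,\nu,m,n$). Thus $S_1,S_2$ are sufficient statistics and the Conway-Maxwell-Binomial distribution is a member of the exponential family; consequently, it has a conjugate prior family.
   Context: The Conway-Maxwell-Binomial (COMB) distribution with parameters $p,\nu$, where $0\le p\le 1$ and $-\infty\le\nu\le\infty$, and with fixed $m$, has probability mass function $$P\{W=k\}=\frac{p^k(1-p)^{m-k}\binom{m}{k}^\nu}{S(p,\nu)},\quad k=0,1,\dots,m,\qquad S(p,\nu)=\sum_{j=0}^m p^j(1-p)^{m-j}\binom{m}{j}^\nu.$$ The likelihood of the $n$ samples is $$p(k_1,\dots,k_n\mid p,\nu)=\frac{\prod_{i=1}^n p^{k_i}(1-p)^{m-k_i}\binom{m}{k_i}^\nu}{[S(p,\nu)]^n}.$$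
   Formalization: Where p is 0 or 1 or ν is infinite the exponential is infinite or undefined, so proportionality is stated exactly for 0<p<1 and finite ν and as limits at the boundary; exponential family and conjugate prior are for 0<p<1 and finite ν. *)

(* Defs.v *)
From mathcomp Require Export all_boot all_order all_algebra.
From mathcomp Require Export all_classical all_reals all_analysis.

Set Implicit Arguments.
Unset Strict Implicit.
Unset Printing Implicit Defensive.

Export Order.TTheory GRing.Theory Num.Theory.
Export numFieldNormedType.Exports.

Local Open Scope classical_set_scope.
Local Open Scope ring_scope.

Section GeneralNotions.
Context {R : realType}.

(* Below, f theta is the probability mass function on X with parameter theta,
   and theta ranges over Par. *)

(* P_f (X = x | T (X) = t). *)
Definition cond_pmf (X : finType) (Y : eqType) (f : X -> R) (T : X -> Y)
    (t : Y) (x : X) : R :=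
  (if T x == t then f x else 0) / \sum_(y | T y == t) f y.

(* The conditional law of the data given T does not depend on theta. *)
Definition sufficient_statistic (Theta : Type) (Par : set Theta) (X : finType)
    (Y : eqType) (f : Theta -> X -> R) (T : X -> Y) : Prop :=
  exists h : Y -> X -> R, forall theta, Par theta ->
    forall t, \sum_(y | T y == t) f theta y != 0 ->
    forall x, cond_pmf (f theta) T t x = h t x.

(* The d-parameter exponential family
     f (x | theta) = h x exp (<eta theta, T x> - A theta),
   with prescribed natural parameter eta and statistic T. *)
Definition exponential_family (Theta : Type) (Par : set Theta) (X : Type)
    (d : nat) (eta : Theta -> d.-tuple R) (T : X -> d.-tuple R)
    (f : Theta -> X -> R) : Prop :=
  exists (h : X -> R) (A : Theta -> R), (forall x, 0 <= h x) /\
    forall theta, Par theta -> forall x,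
      f theta x =
      h x * expR (\sum_(i < d) tnth (eta theta) i * tnth (T x) i - A theta).

Definition prior_density (disp : measure_display)
    (Theta : measurableType disp) (mu : {measure set Theta -> \bar R})
    (Par : set Theta) (pi : Theta -> R) : Prop :=
  [/\ measurable_fun Par pi, (forall theta, Par theta -> 0 <= pi theta) &
      (\int[mu]_(theta in Par) (pi theta)%:E = 1)%E].

(* Bayes' rule, densities being taken with respect to mu. *)
Definition posterior_density (disp : measure_display)
    (Theta : measurableType disp) (mu : {measure set Theta -> \bar R})
    (Par : set Theta) (X : Type) (f : Theta -> X -> R) (pi : Theta -> R)
    (x : X) (theta : Theta) : R :=
  f theta x * pi theta / Rintegral mu Par (fun t => f t x * pi t).

(* The densities [pi h], for [h] in the set [H] of hyperparameters, are
   (proper) priors, and they are closed under Bayesian updating. *)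
Definition conjugate_family (disp : measure_display)
    (Theta : measurableType disp) (mu : {measure set Theta -> \bar R})
    (Par : set Theta) (X : Type) (f : Theta -> X -> R)
    (Hyp : Type) (H : set Hyp) (pi : Hyp -> Theta -> R) : Prop :=
  (forall h, H h -> prior_density mu Par (pi h)) /\
  (forall h, H h -> forall x : X, exists h', H h' /\
     forall theta, Par theta ->
       posterior_density mu Par f (pi h) x theta = pi h' theta).

End GeneralNotions.

(* The plane with its Borel sigma-algebra; measurableTypeR R, not R, is the type
   on which lebesgue_measure is declared. *)
Notation param_plane R := (measurableTypeR R * measurableTypeR R)%type.

Section COMB.
Context {R : realType}.

Definition comb_weight (m : nat) (p nu : R) (k : 'I_m.+1) : R :=
  p ^+ k * (1 - p) ^+ (m - k) * ('C(m, k)%:R `^ nu).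

Definition comb_S (m : nat) (p nu : R) : R :=
  \sum_(j < m.+1) @comb_weight m p nu j.

Definition comb_pmf_fin (m : nat) (p nu : R) (k : 'I_m.+1) : R :=
  comb_weight p nu k / comb_S m p nu.

(* For nu = +oo or -oo the closed formula is of the form oo / oo or needs
   conventions such as 1 ^ oo = 1; the distribution is the limit of those with
   finite nu and the same p. *)
Definition comb_pmf (m : nat) (p : R) (nu : \bar R) (k : 'I_m.+1) : R :=
  match nu with
  | r%:E => comb_pmf_fin p r k
  | +oo%E => lim (comb_pmf_fin p r k @[r --> +oo])
  | -oo%E => lim (comb_pmf_fin p r k @[r --> -oo])
  end.

(* The joint probability mass function of n independent samples. *)
Definition comb_likelihood (m n : nat) (p : R) (nu : \bar R)
    (k : {ffun 'I_n -> 'I_m.+1}) : R :=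
  \prod_(i < n) comb_pmf p nu (k i).

Lemma comb_likelihoodE (m n : nat) (p nu : R) (k : {ffun 'I_n -> 'I_m.+1}) :
  comb_likelihood p nu%:E k =
  (\prod_(i < n) (p ^+ k i * (1 - p) ^+ (m - k i) * ('C(m, k i)%:R `^ nu)))
  / comb_S m p nu ^+ n.
Proof. by rewrite /comb_likelihood /= big_split /= prodr_const card_ord exprVn. Qed.

Definition comb_logfact (m : nat) (k : 'I_m.+1) : R :=
  ln (k`! * (m - k)`!)%N%:R.

Definition comb_S1 (m n : nat) (k : {ffun 'I_n -> 'I_m.+1}) : R :=
  \sum_(i < n) (k i)%:R.

Definition comb_S2 (m n : nat) (k : {ffun 'I_n -> 'I_m.+1}) : R :=
  \sum_(i < n) comb_logfact (k i).

Definition logit (p : R) : R := ln (p / (1 - p)).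

Definition comb_kernel (m n : nat) (p nu : R) (k : {ffun 'I_n -> 'I_m.+1}) : R :=
  expR (comb_S1 k * logit p - nu * comb_S2 k).

Definition comb_par : set (R * \bar R) := [set th | 0 <= th.1 <= 1].
Definition comb_int : set (param_plane R) := [set th | 0 < th.1 < 1].

Definition comb_logZ (m : nat) (p nu : R) : R :=
  ln (\sum_(j < m.+1) expR (j%:R * logit p - nu * @comb_logfact m j)).

(* The hyperparameter h = (a, b, c) stands for the prior density proportional
   to exp (a logit p - b nu) / Z (p, nu) ^ c, where log Z = comb_logZ: formally
   the likelihood of c earlier samples with S1 = a and S2 = b. *)
Definition comb_prior_kernel (m : nat) (h : R * R * R) (th : param_plane R) : R :=
  expR (h.1.1 * logit th.1 - h.1.2 * th.2 - h.2 * comb_logZ m th.1 th.2).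

Definition comb_proper (m : nat) (mu : {measure set (param_plane R) -> \bar R}) :
    set (R * R * R) :=
  [set h | (0 < \int[mu]_(th in comb_int) (comb_prior_kernel m h th)%:E
              < +oo)%E].

Definition comb_prior (m : nat) (mu : {measure set (param_plane R) -> \bar R})
    (h : R * R * R) (th : param_plane R) : R :=
  comb_prior_kernel m h th / Rintegral mu comb_int (comb_prior_kernel m h).

Definition lebesgue2 : {measure set (param_plane R) -> \bar R} :=
  (@lebesgue_measure R \x @lebesgue_measure R)%E.

End COMB.

(* Main.v *)
Require Import Defs.
From mathcomp Require Import ring lra measurable_realfun.

(* For 0 < p < 1 and finite nu, C(m, k) = m! / (k! (m - k)!) turns the
   probability of k into exp (k logit p - nu log (k! (m - k)!) - log Z), which
   gives the exponential family form, and the likelihood into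
   exp (S1 logit p - nu S2 - n log Z).  Multiplying the prior kernel by the
   likelihood hence just shifts the hyperparameter by (S1, S2, n), and the
   shifted kernel is still integrable because the likelihood lies in ]0, 1].

   The boundary of the parameter region is reached by limits: the probability of
   k is continuous in p on [0, 1], and as a function of nu it is a ratio of sums
   of exponentials with nonnegative coefficients, hence converges at +oo and -oo.
   So on the whole region the likelihood is a function of (S1, S2), and the
   conditional law given (S1, S2) is uniform on the fiber.

   For Lebesgue measure and m >= 2, the posterior kernel of the flat prior after
   the samples 0, 1 and m is at most exp (- |nu| log m), which is integrable on
   ]0, 1[ x R. *)

Set Implicit Arguments.
Unset Strict Implicit.
Unset Printing Implicit Defensive.

Local Open Scope classical_set_scope.
Local Open Scope ring_scope.

(** * Limits of finite sums and products, and of ratios of sums of real powers *)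

Lemma cvg_sumR {R : numFieldType} (T : Type) (F : set_system T) (I : Type)
    (r : seq I) (f : I -> T -> R) (l : I -> R) : Filter F ->
  (forall i, f i x @[x --> F] --> l i) ->
  (\sum_(i <- r) f i x) @[x --> F] --> \sum_(i <- r) l i.
Proof. by move=> FF fl; apply: cvg_big => //; exact: add_continuous. Qed.

Lemma cvg_prodR {R : numFieldType} (T : Type) (F : set_system T) (I : Type)
    (r : seq I) (f : I -> T -> R) (l : I -> R) : Filter F ->
  (forall i, f i x @[x --> F] --> l i) ->
  (\prod_(i <- r) f i x) @[x --> F] --> \prod_(i <- r) l i.
Proof. by move=> FF fl; apply: cvg_big => //; exact: mul_continuous. Qed.

Lemma powR_cvgy0 {R : realType} (b : R) : 0 < b -> b < 1 ->
  b `^ r @[r --> +oo] --> 0.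
Proof.
move=> b0 b1.
rewrite (_ : (fun r => b `^ r) = (fun x => expR (- x)) \o (fun r => - ln b * r)).
  apply: (@cvg_comp _ _ _ _ _ _ (pinfty_nbhs R)); last exact: cvgr_expR.
  apply: gt0_cvgMry; last exact: cvg_id.
  by rewrite oppr_gt0 ln_lt0// b0.
by apply/funext => r /=; rewrite mulNr opprK mulrC /powR gt_eqF.
Qed.

(* Dividing through by the r-th power of the largest base with positive
   coefficient leaves bases at most 1, whose powers tend to 0 or 1. *)
Lemma is_cvg_powR_ratio {R : realType} (I : finType) (a x : I -> R) :
  (forall i, 0 <= a i) -> (forall i, 0 < x i) -> (exists i, 0 < a i) ->
  forall k, cvg (a k * x k `^ r / (\sum_i a i * x i `^ r) @[r --> +oo]).
Proof.
move=> a0 x0 [i1 ai1] k.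
case: (@arg_maxP _ _ _ i1 (fun i => 0 < a i) x ai1) => i0 ai0 max; set M := x i0.
have M0 : 0 < M by exact: x0.
pose t i r := a i * (x i / M) `^ r.
have tl i : t i r @[r --> +oo] --> a i * (x i == M)%:R.
  (* [M] is maximal only among bases with positive coefficient, so a term with [a i = 0] may have a
     base above [M] and is treated apart. *)
  rewrite /t; have [ai|ai] := eqVneq (a i) 0.
    by under eq_cvg do rewrite ai mul0r; rewrite ai mul0r; exact: cvg_cst.
  apply: cvgMl_tmp; have [xM|xM] := eqVneq (x i) M.
    by under eq_cvg do rewrite xM divff ?gt_eqF// powR1; exact: cvg_cst.
  apply: powR_cvgy0; first exact: divr_gt0.
  rewrite ltr_pdivrMr// mul1r lt_neqAle xM.
  by apply: max; rewrite lt_neqAle eq_sym ai a0.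
rewrite (_ : (fun r => _) = (fun r => t k r / \sum_i t i r)); last first.
  apply/funext => r.
  have tE i : t i r = a i * x i `^ r * (M `^ r)^-1.
    by rewrite /t powRM ?ltW ?invr_gt0// -powR_inv1 ?ltW// -powRrM mulN1r powRN mulrA.
  rewrite tE; under [in RHS]eq_bigr do rewrite tE.
  rewrite -mulr_suml invfM invrK mulrACA mulVf ?mulr1//.
  by rewrite gt_eqF// powR_gt0.
apply/cvg_ex; eexists; apply: cvgM; first exact: tl.
apply: cvgV; last exact: cvg_sumR tl.
(* The limit of the denominator is nonzero: the index [i0] alone contributes [a i0 > 0]. *)
rewrite gt_eqF// (bigD1 i0)//= eqxx mulr1 ltr_wpDr//.
by apply: sumr_ge0 => i _; rewrite mulr_ge0.
Qed.

(** * The probability mass function: positivity, exponential form and limits *)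

Section COMB_pmf.
Context {R : realType} (m : nat).
Implicit Types (p nu : R) (k : 'I_m.+1).

Lemma comb_bin_gt0 k : 0 < 'C(m, k)%:R :> R.
Proof. by rewrite ltr0n bin_gt0 -ltnS. Qed.

Lemma comb_weight_ge0 p nu k : 0 <= p <= 1 -> 0 <= comb_weight p nu k.
Proof.
move=> /andP[p0 p1].
by rewrite !mulr_ge0 ?exprn_ge0 ?powR_ge0 ?subr_ge0.
Qed.

(** Since [0 ^+ 0 = 1], some weight survives even at the endpoints: [k = m] for [p = 1], and [k = 0]
    otherwise. *)
Lemma comb_base_gt0 p : 0 <= p <= 1 ->
  exists k, 0 < p ^+ k * (1 - p) ^+ (m - k).
Proof.
move=> /andP[p0 p1]; have [->|pn1] := eqVneq p 1.
  by exists ord_max; rewrite /= subnn subrr expr1n mul1r expr0.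
exists ord0; rewrite /= expr0 mul1r exprn_gt0// subr_gt0.
by rewrite lt_neqAle pn1.
Qed.

Lemma comb_S_gt0 p nu : 0 <= p <= 1 -> 0 < comb_S m p nu.
Proof.
move=> p01; have [k k0] := comb_base_gt0 p01.
rewrite /comb_S (bigD1 k)//= ltr_wpDr//.
  by apply: sumr_ge0 => i _; exact: comb_weight_ge0.
by rewrite mulr_gt0// powR_gt0// comb_bin_gt0.
Qed.

Lemma comb_fact_gt0 k : 0 < (k`! * (m - k)`!)%N%:R :> R.
Proof. by rewrite ltr0n muln_gt0 !fact_gt0. Qed.

Lemma powR_binE nu k :
  'C(m, k)%:R `^ nu = expR (nu * ln m`!%:R) * expR (- (nu * comb_logfact k)) :> R.
Proof.
rewrite /powR gt_eqF ?comb_bin_gt0// -expRD -mulrBr -(bin_fact (leq_ord k)).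
by rewrite natrM lnM ?posrE ?comb_bin_gt0 ?comb_fact_gt0// addrK.
Qed.

Lemma logitE p : 0 < p < 1 -> logit p = ln p - ln (1 - p).
Proof.
by move=> /andP[p0 p1]; rewrite /logit ln_div ?posrE ?subr_gt0.
Qed.

Lemma expR_logit p k : 0 < p < 1 ->
  p ^+ k * (1 - p) ^+ (m - k) = (1 - p) ^+ m * expR (k%:R * logit p).
Proof.
move=> /andP[p0 p1]; have q0 : 0 < 1 - p by rewrite subr_gt0.
rewrite expRM_natl /logit lnK ?posrE ?divr_gt0// expr_div_n.
have -> : (1 - p) ^+ m = (1 - p) ^+ (m - k) * (1 - p) ^+ k.
  by rewrite -exprD subnK// leq_ord.
rewrite mulrC -mulrA; congr (_ * _).
by rewrite mulrCA divff ?mulr1// gt_eqF// exprn_gt0.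
Qed.

(** The partition function whose logarithm is [comb_logZ]; for [0 < p < 1] it is [comb_S] divided by
    [(1 - p) ^+ m] and by the [nu]-th power of [m!]. *)
Definition comb_Z p nu : R :=
  \sum_(j < m.+1) expR (j%:R * logit p - nu * @comb_logfact R m j).

Lemma comb_Z_gt0 p nu : 0 < comb_Z p nu.
Proof.
rewrite /comb_Z big_ord_recl ltr_wpDr ?expR_gt0//.
by apply: sumr_ge0 => i _; exact: expR_ge0.
Qed.

(** All weights share the factor [A], which does not depend on [k] and cancels against the
    normalizer. *)
Lemma comb_pmf_finE p nu k : 0 < p < 1 ->
  comb_pmf_fin p nu k =
  expR (k%:R * logit p - nu * comb_logfact k - comb_logZ m p nu).
Proof.
move=> p01; have /andP[p0 p1] := p01.
pose A := (1 - p) ^+ m * expR (nu * ln m`!%:R).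
have wE j : comb_weight p nu j =
    A * expR (j%:R * logit p - nu * @comb_logfact R m j).
  by rewrite /comb_weight expR_logit// powR_binE expRD mulrACA.
have A0 : A != 0.
  by rewrite gt_eqF// mulr_gt0 ?expR_gt0// exprn_gt0// subr_gt0.
rewrite /comb_pmf_fin /comb_S; under eq_bigr do rewrite wE.
rewrite wE -mulr_sumr -/(comb_Z p nu) [RHS]expRB /comb_logZ lnK ?posrE ?comb_Z_gt0//.
by rewrite -mulf_div divff// mul1r.
Qed.

Lemma comb_pmf_fin_ge0 p nu k : 0 <= p <= 1 -> 0 <= comb_pmf_fin p nu k.
Proof. by move=> p01; rewrite divr_ge0 ?comb_weight_ge0// ltW// comb_S_gt0. Qed.

Lemma comb_pmf_fin_le1 p nu k : 0 <= p <= 1 -> comb_pmf_fin p nu k <= 1.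
Proof.
move=> p01; rewrite ler_pdivrMr ?comb_S_gt0// mul1r /comb_S (bigD1 k)//=.
by rewrite lerDl sumr_ge0// => i _; exact: comb_weight_ge0.
Qed.

Lemma is_cvg_comb_pmf_finy p k : 0 <= p <= 1 ->
  cvg (comb_pmf_fin p r k @[r --> +oo]).
Proof.
move=> p01; have /andP[p0 p1] := p01; apply: is_cvg_powR_ratio.
- by move=> i; rewrite mulr_ge0// exprn_ge0// subr_ge0.
- exact: comb_bin_gt0.
- exact: comb_base_gt0.
Qed.

(** The substitution of [- r] for [r] inverts the bases and reduces the claim to a limit at
    [+oo]. *)
Lemma is_cvg_comb_pmf_finNy p k : 0 <= p <= 1 ->
  cvg (comb_pmf_fin p r k @[r --> -oo]).
Proof.
move=> p01; have /andP[p0 p1] := p01.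
suff : cvg (comb_pmf_fin p (- r) k @[r --> +oo]).
  by move=> /cvg_ex[l pl]; apply/cvg_ex; exists l; exact/cvgNy_compNP.
have binN i (r : R) : 'C(m, i : 'I_m.+1)%:R `^ (- r) = 'C(m, i)%:R^-1 `^ r :> R.
  by rewrite -[in RHS]powR_inv1// -powRrM mulN1r.
pose a (i : 'I_m.+1) := p ^+ i * (1 - p) ^+ (m - i).
pose y (i : 'I_m.+1) : R := 'C(m, i)%:R^-1.
have a0 i : 0 <= a i by rewrite mulr_ge0// exprn_ge0// subr_ge0.
have y0 i : 0 < y i by rewrite invr_gt0 comb_bin_gt0.
have := is_cvg_powR_ratio a0 y0 (comb_base_gt0 p01) (k := k).
rewrite (_ : (fun r => _) = (fun r => comb_pmf_fin p (- r) k))//.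
apply/funext => r; rewrite /comb_pmf_fin /comb_S /comb_weight binN.
by under [in RHS]eq_bigr do rewrite binN.
Qed.

Context (n : nat).
Implicit Types x : {ffun 'I_n -> 'I_m.+1}.

Lemma cvg_comb_likelihoody p x : 0 <= p <= 1 ->
  comb_likelihood p nu%:E x @[nu --> +oo] --> comb_likelihood p +oo%E x.
Proof. by move=> p01; apply: cvg_prodR => i; exact: is_cvg_comb_pmf_finy. Qed.

Lemma cvg_comb_likelihoodNy p x : 0 <= p <= 1 ->
  comb_likelihood p nu%:E x @[nu --> -oo] --> comb_likelihood p -oo%E x.
Proof. by move=> p01; apply: cvg_prodR => i; exact: is_cvg_comb_pmf_finNy. Qed.

Lemma comb_likelihood_kernel p nu x : 0 < p < 1 ->
  comb_likelihood p nu%:E x =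
  expR (- (n%:R * comb_logZ m p nu)) * comb_kernel p nu x.
Proof.
move=> p01; rewrite /comb_likelihood /comb_pmf.
under eq_bigr do rewrite comb_pmf_finE//.
rewrite -expR_sum /comb_kernel -expRD; congr expR.
rewrite big_split/= sumrB -mulr_suml -mulr_sumr sumr_const card_ord.
by rewrite addrC mulr_natl mulNrn.
Qed.

(** The filter is arbitrary so that one statement serves the right limit at [p = 0] and the left
    limit at [p = 1]. *)
Lemma cvg_comb_likelihood (F : set_system R) p nu x : Filter F -> F --> p ->
  0 <= p <= 1 ->
  comb_likelihood q nu%:E x @[q --> F] --> comb_likelihood p nu%:E x.
Proof.
move=> FF Fp p01; apply: cvg_prodR => i.
have wc (j : 'I_m.+1) : comb_weight q nu j @[q --> F] --> comb_weight p nu j.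
  apply: cvgMr_tmp; apply: cvgM.
    exact: (cvg_comp _ _ Fp (@exprn_continuous _ j p)).
  apply: (@cvg_comp _ _ _ (fun q => 1 - q) (fun z => z ^+ (m - j)) F
    (nbhs (1 - p))); last exact: exprn_continuous.
  by apply: cvgB => //; exact: cvg_cst.
apply: cvgM; first exact: wc.
apply: cvgV; first by rewrite gt_eqF// comb_S_gt0.
by apply: cvg_sumR => j; exact: wc.
Qed.

End COMB_pmf.

(** * Sufficiency, exponential family and proportionality of the likelihood *)

Lemma sufficient_statistic_fiber {R : realType} (Theta : Type)
    (Par : set Theta) (X : finType) (Y : eqType) (f : Theta -> X -> R)
    (T : X -> Y) :
  (forall th, Par th -> forall x y, T x = T y -> f th x = f th y) ->
  sufficient_statistic Par f T.
Proof.
move=> fT.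
exists (fun t x => if T x == t then #|[pred y | T y == t]|%:R^-1 else 0).
move=> th Pth t + x; rewrite /cond_pmf; case: (eqVneq (T x) t) => [Txt|_ _]; last exact: mul0r.
have -> : \sum_(y | T y == t) f th y = f th x *+ #|[pred y | T y == t]|.
  by rewrite -sumr_const; apply: eq_bigr => y /eqP Tyt; apply: fT; rewrite // Tyt.
rewrite mulrn_eq0 negb_or => /andP[_ fx0].
by rewrite -(mulr_natl (f th x)) invfM mulrCA divff// mulr1.
Qed.

Section COMB_statistics.
Context {R : realType} (m n : nat).
Implicit Types x y : {ffun 'I_n -> 'I_m.+1}.

(** The argument keeps the powers of [p] and [1 - p] instead of passing to [logit p], so that no
    restriction on [p] is needed. *)
Lemma comb_likelihood_fin_fiber (p nu : R) x y :
  comb_S1 x = comb_S1 y :> R -> comb_S2 x = comb_S2 y :> R ->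
  comb_likelihood p nu%:E x = comb_likelihood p nu%:E y.
Proof.
move=> S1 S2.
(* The exponents of [p] and [1 - p] are natural numbers, so the equality of [S1] is pulled back from
   the reals. *)
have sE : (\sum_(i < n) x i = \sum_(i < n) y i)%N.
  by apply/eqP; rewrite -(eqr_nat R) !natr_sum; apply/eqP.
have LE (z : {ffun 'I_n -> 'I_m.+1}) : comb_likelihood p nu%:E z =
    p ^+ (\sum_(i < n) z i) * (1 - p) ^+ (n * m - \sum_(i < n) z i) *
    (expR (nu * ln m`!%:R) ^+ n * expR (- (nu * comb_S2 z))) / comb_S m p nu ^+ n.
  rewrite comb_likelihoodE !big_split/= -!expr_sum; congr (_ * _ * _ / _).
    rewrite sumnB => [|i _]; last exact: leq_ord.
    by rewrite sum_nat_const card_ord.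
  under eq_bigr do rewrite powR_binE.
  by rewrite big_split/= prodr_const card_ord -expR_sum sumrN mulr_sumr.
by rewrite !LE sE S2.
Qed.

(* For infinite nu the likelihood is a limit of likelihoods with finite nu. *)
Lemma comb_likelihood_fiber (p : R) (nu : \bar R) x y : 0 <= p <= 1 ->
  comb_S1 x = comb_S1 y :> R -> comb_S2 x = comb_S2 y :> R ->
  comb_likelihood p nu x = comb_likelihood p nu y.
Proof.
move=> p01 S1 S2.
have xy : (fun r : R => comb_likelihood p r%:E x) =
          (fun r => comb_likelihood p r%:E y).
  by apply/funext => r; exact: comb_likelihood_fin_fiber.
case: nu => [nu||]; first exact: comb_likelihood_fin_fiber.
  have := @cvg_comb_likelihoody _ _ _ _ x p01; rewrite xy => xl.
  apply: (cvg_unique _ xl) => //.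
  exact: cvg_comb_likelihoody.
have := @cvg_comb_likelihoodNy _ _ _ _ x p01; rewrite xy => xl.
  apply: (cvg_unique _ xl) => //.
exact: cvg_comb_likelihoodNy.
Qed.

Lemma comb_sufficient_statistic :
  sufficient_statistic (@comb_par R)
    (fun th => @comb_likelihood R m n th.1 th.2)
    (fun k => (comb_S1 k, comb_S2 k) : R * R).
Proof.
apply: sufficient_statistic_fiber => th th01 x y [S1 S2].
exact: comb_likelihood_fiber.
Qed.

Lemma comb_exponential_family :
  exponential_family (@comb_int R)
    (fun th => [tuple logit th.1; - th.2])
    (fun k : 'I_m.+1 => [tuple k%:R; comb_logfact k])
    (fun th => comb_pmf th.1 th.2%:E).
Proof.
exists (fun=> 1), (fun th => comb_logZ m th.1 th.2); split => // th th01 k.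
rewrite /= comb_pmf_finE// mul1r !big_ord_recl big_ord0 addr0/=.
by rewrite !(tnth_nth 0)/= mulNr [logit _ * _]mulrC.
Qed.

Lemma comb_likelihood_proportional : exists c : R -> R -> R,
  (forall p nu : R, 0 < p < 1 -> 0 < c p nu /\
     forall k : {ffun 'I_n -> 'I_m.+1},
       comb_likelihood p nu%:E k = c p nu * comb_kernel p nu k) /\
  (forall (nu : R) (k : {ffun 'I_n -> 'I_m.+1}),
     (c p nu * comb_kernel p nu k @[p --> 0^'+]
        --> comb_likelihood 0 nu%:E k) /\
     (c p nu * comb_kernel p nu k @[p --> 1^'-]
        --> comb_likelihood 1 nu%:E k)) /\
  (forall p : R, 0 < p < 1 -> forall k : {ffun 'I_n -> 'I_m.+1},
     (c p nu * comb_kernel p nu k @[nu --> +oo]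
        --> comb_likelihood p +oo%E k) /\
     (c p nu * comb_kernel p nu k @[nu --> -oo]
        --> comb_likelihood p -oo%E k)) /\
  (forall p : R, p = 0 \/ p = 1 -> forall k : {ffun 'I_n -> 'I_m.+1},
     (comb_likelihood p nu%:E k @[nu --> +oo]
        --> comb_likelihood p +oo%E k) /\
     (comb_likelihood p nu%:E k @[nu --> -oo]
        --> comb_likelihood p -oo%E k)).
Proof.
(* The constant is [Z ^ (- n)], one normalizer per sample. *)
exists (fun p nu => expR (- (n%:R * comb_logZ m p nu))); split; [|split; [|split]].
- move=> p nu p01; split; first exact: expR_gt0.
  by move=> k; exact: comb_likelihood_kernel.
(* Near an endpoint [p] lies in the open interval, where the product equals the likelihood, and the
   latter is continuous up to the endpoint. *)
- move=> nu k; split.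
    have c0 : comb_likelihood q nu%:E k @[q --> 0^'+] --> comb_likelihood 0 nu%:E k.
      by apply: cvg_comb_likelihood; [exact: cvg_at_right_filter|rewrite lexx ler01].
    have p01 : \forall p \near (0 : R)^'+, 0 < p < 1.
      near=> p; apply/andP; split; near: p; first exact: nbhs_right_gt.
      exact: nbhs_right_lt.
    apply: cvg_trans c0; apply: near_eq_cvg; apply: filterS p01 => p p01.
    by rewrite /= comb_likelihood_kernel.
  have c1 : comb_likelihood q nu%:E k @[q --> 1^'-] --> comb_likelihood 1 nu%:E k.
    by apply: cvg_comb_likelihood; [exact: cvg_at_left_filter|rewrite lexx ler01].
  have p01 : \forall p \near (1 : R)^'-, 0 < p < 1.
    near=> p; apply/andP; split; near: p; last exact: nbhs_left_lt.
    exact: nbhs_left_gt.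
  apply: cvg_trans c1; apply: near_eq_cvg; apply: filterS p01 => p p01.
  by rewrite /= comb_likelihood_kernel.
- move=> p p01 k; have p01' : 0 <= p <= 1 by case/andP: p01 => /ltW-> /ltW->.
  under eq_cvg do rewrite -(comb_likelihood_kernel _ _ p01).
  under [X in _ /\ X]eq_cvg do rewrite -(comb_likelihood_kernel _ _ p01).
  split; [exact: cvg_comb_likelihoody|exact: cvg_comb_likelihoodNy].
- move=> p p01 k; have p01' : 0 <= p <= 1 by case: p01 => ->; rewrite lexx ler01.
  by split; [exact: cvg_comb_likelihoody|exact: cvg_comb_likelihoodNy].
Unshelve. all: by end_near. Qed.

End COMB_statistics.

(** * Conjugate priors for an arbitrary reference measure *)

Section COMB_priors.
Context {R : realType} (m : nat).
Implicit Types (h : R * R * R) (th : param_plane R)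
  (mu : {measure set (param_plane R) -> \bar R}).

Lemma comb_intE : @comb_int R = `]0, 1[%classic `*` setT.
Proof. by apply/seteqP; split => th /=; rewrite in_itv//= => -[]. Qed.

Lemma measurable_comb_int : measurable (@comb_int R).
Proof. by rewrite comb_intE; apply: measurableX => //; exact: measurable_itv. Qed.

Lemma measurable_comb_prior_kernel h :
  measurable_fun (@comb_int R) (comb_prior_kernel m h).
Proof.
(* [L] agrees with the logit on [comb_int] and is measurable on the whole plane, as no division
   occurs in it. *)
pose L th := ln th.1 - ln (1 - th.1).
have mL : measurable_fun setT L.
  apply: measurable_funB; first exact: measurableT_comp.
  apply: measurableT_comp; first exact: measurable_ln.
  by apply: measurable_funB.
apply: (@eq_measurable_fun _ _ _ _ _ (fun th =>
    expR (h.1.1 * L th - h.1.2 * th.2 - h.2 *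
      ln (\sum_(j < m.+1) expR (j%:R * L th - th.2 * comb_logfact j))))).
  move=> th /set_mem th01.
  by rewrite /comb_prior_kernel /comb_logZ !logitE.
apply: measurable_funTS; apply: measurableT_comp => //.
apply: measurable_funB; first by apply: measurable_funB; exact: measurable_funM.
apply: measurable_funM => //; apply: measurableT_comp => //.
apply: measurable_sum => j; apply: measurableT_comp => //.
by apply: measurable_funB; exact: measurable_funM.
Qed.

Lemma comb_prior_kernel_gt0 h th : 0 < comb_prior_kernel m h th.
Proof. exact: expR_gt0. Qed.

Lemma measurable_comb_prior_kernelE h :
  measurable_fun (@comb_int R) (EFin \o comb_prior_kernel m h).
Proof. by apply/measurable_EFinP; exact: measurable_comb_prior_kernel. Qed.

Lemma comb_proper_Rintegral_gt0 mu h : comb_proper m mu h ->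
  0 < Rintegral mu (@comb_int R) (comb_prior_kernel m h).
Proof. exact: fine_gt0. Qed.

Lemma integrable_comb_prior_kernel mu h : comb_proper m mu h ->
  mu.-integrable (@comb_int R) (EFin \o comb_prior_kernel m h).
Proof.
move=> /andP[_ foo]; apply/integrableP; split.
  exact: measurable_comb_prior_kernelE.
by under eq_integral do rewrite /= gtr0_norm ?comb_prior_kernel_gt0//.
Qed.

(** A zero integral would make the strictly positive kernel vanish almost everywhere, and [comb_int]
    would be a null set. *)
Lemma comb_prior_kernel_integral_gt0 mu h : (0 < mu (@comb_int R))%E ->
  (0 < \int[mu]_(th in @comb_int R) (comb_prior_kernel m h th)%:E)%E.
Proof.
move=> mu0; rewrite lt0e integral_ge0 ?andbT; last first.
  by move=> th _; rewrite lee_fin ltW// comb_prior_kernel_gt0.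
apply: contraTneq mu0 => K0.
have : (\int[mu]_(th in @comb_int R) `|(comb_prior_kernel m h th)%:E| = 0)%E.
  rewrite -[RHS]K0; apply: eq_integral => th _.
  by rewrite gee0_abs// lee_fin ltW// comb_prior_kernel_gt0.
move/(ae_eq_integral_abs _ measurable_comb_int (measurable_comb_prior_kernelE h)).
move=> [N [mN N0 KN]]; rewrite -leNgt -N0 le_measure ?inE//.
  exact: measurable_comb_int.
move=> th th01; apply: KN => /= /(_ th01) [] /eqP.
by rewrite gt_eqF// comb_prior_kernel_gt0.
Qed.

Lemma comb_prior_density mu h : comb_proper m mu h ->
  prior_density mu (@comb_int R) (comb_prior m mu h).
Proof.
move=> hp; have c0 := comb_proper_Rintegral_gt0 hp; split.
- by apply: measurable_funM => //; exact: measurable_comb_prior_kernel.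
- by move=> th _; rewrite divr_ge0// ltW// comb_prior_kernel_gt0.
- under eq_integral do rewrite EFinM.
  rewrite ge0_integralZr//.
  + have Koo : (\int[mu]_(th in @comb_int R) (comb_prior_kernel m h th)%:E)%E
        \is a fin_num.
      by rewrite fin_numElt; case/andP: hp => K0 ->; rewrite (lt_trans _ K0)// ltNyr.
    by rewrite -(fineK Koo) -EFinM divff// gt_eqF.
  + exact: measurable_comb_int.
  + exact: measurable_comb_prior_kernelE.
  + by move=> th _; rewrite lee_fin ltW// comb_prior_kernel_gt0.
  + by rewrite lee_fin invr_ge0 ltW.
Qed.

Context (n : nat).
Implicit Types x : {ffun 'I_n -> 'I_m.+1}.

Definition comb_update h x : R * R * R :=
  (h.1.1 + comb_S1 x, h.1.2 + comb_S2 x, h.2 + n%:R).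

Lemma comb_prior_kernel_update h x th : comb_int th ->
  comb_likelihood th.1 th.2%:E x * comb_prior_kernel m h th =
  comb_prior_kernel m (comb_update h x) th.
Proof.
move=> th01; rewrite comb_likelihood_kernel// -!expRD; congr expR => /=.
by ring.
Qed.

(* The integral stays finite because the likelihood is at most 1, and
   positive because the likelihood does not vanish on [comb_int]. *)
Lemma comb_proper_update mu h x : comb_proper m mu h ->
  comb_proper m mu (comb_update h x).
Proof.
move=> /andP[K0 Koo]; apply/andP; split.
  apply: comb_prior_kernel_integral_gt0; rewrite lt0e measure_ge0 andbT.
  apply: contraTneq K0 => mu0; rewrite -leNgt.
  by rewrite null_set_integral//; [exact: measurable_comb_int|exact: measurable_comb_prior_kernelE].
apply: le_lt_trans Koo; apply: ge0_le_integral => //.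
- exact: measurable_comb_int.
- by move=> th _; rewrite lee_fin ltW// comb_prior_kernel_gt0.
- exact: measurable_comb_prior_kernelE.
- exact: measurable_comb_prior_kernelE.
- move=> th th01; rewrite lee_fin -comb_prior_kernel_update//.
  rewrite ler_piMl ?(ltW (comb_prior_kernel_gt0 _ _))//.
  have th01' : 0 <= th.1 <= 1 by case/andP: th01 => /ltW-> /ltW->.
  apply: prodr_ile1 => i _.
  by rewrite comb_pmf_fin_ge0// comb_pmf_fin_le1.
Qed.

Lemma comb_conjugate_family mu :
  conjugate_family mu (@comb_int R)
    (fun th => @comb_likelihood R m n th.1 th.2%:E)
    (comb_proper m mu) (comb_prior m mu).
Proof.
split=> h hp; first exact: comb_prior_density.
move=> x; exists (comb_update h x); split; first exact: comb_proper_update.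
move=> th th01; rewrite /posterior_density /comb_prior.
set c := Rintegral mu _ (comb_prior_kernel m h).
have c0 : c != 0 by rewrite gt_eqF// comb_proper_Rintegral_gt0.
(* The normalizer [c] of the prior factors out of the evidence and cancels against the one in the
   numerator. *)
have -> : Rintegral mu (@comb_int R)
    (fun t => comb_likelihood t.1 t.2%:E x * (comb_prior_kernel m h t / c)) =
    Rintegral mu (@comb_int R) (comb_prior_kernel m (comb_update h x)) / c.
  rewrite -RintegralZr; last 2 first.
    exact: measurable_comb_int.
    exact/integrable_comb_prior_kernel/comb_proper_update.
  apply: eq_Rintegral => t /set_mem t01.
  by rewrite mulrA comb_prior_kernel_update.
by rewrite mulrA comb_prior_kernel_update// -mulf_div divff ?invr_neq0// mulr1.
Qed.

Lemma comb_proper_finite mu : (0 < mu (@comb_int R) < +oo)%E ->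
  comb_proper m mu !=set0.
Proof.
(* At the zero hyperparameter the kernel is constantly 1, and its integral is the mass of
   [comb_int]. *)
move=> mu01; exists (0, 0, 0); rewrite /comb_proper/=.
rewrite (_ : (\int[mu]_(th in _) _)%E = mu (@comb_int R))//.
rewrite -[RHS]mul1e -integral_cst; last exact: measurable_comb_int.
by apply: eq_integral => th _; rewrite /comb_prior_kernel/= !mul0r !subr0 expR0.
Qed.

End COMB_priors.

(* For [s] and [nu] of the same sign the bound comes from the first two of the
   three exponents, otherwise from the last two. *)
Lemma three_point_bound {R : realFieldType} (M s nu D l z : R) : 1 < M ->
  M * s - nu * (D + l) - z <= 0 -> s - nu * l - z <= 0 ->
  - (nu * (D + l)) - z <= 0 ->
  - (nu * (D + l)) - z + (s - nu * l - z + (M * s - nu * (D + l) - z)) <=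
  - (D * `|nu|).
Proof.
move=> M1 aM a1 a0.
have [nu0|nu0] := leP 0 nu; [rewrite ger0_norm//|rewrite ltr0_norm//];
  have [s0|s0] := leP 0 s; nra.
Qed.

(** * Existence of a proper prior for Lebesgue measure *)

Section Lebesgue_prior.
Context {R : realType}.

Lemma continuous_expR_abs (d : R) : continuous (fun y : R => expR (- (d * `|y|))).
Proof.
move=> y; apply: (@continuous_comp _ _ _ (fun y : R => - (d * `|y|)) expR); last first.
  exact: continuous_expR.
apply: (@continuousN _ R^o); apply: continuousM; first exact: cst_continuous.
exact: norm_continuous.
Qed.

(** By symmetry the integral is twice the one over the half-line, where the integrand is [d^-1]
    times the exponential density of rate [d]. *)
Lemma integral_expR_abs_lty (d : R) : 0 < d ->
  (\int[lebesgue_measure]_(y in [set: R]) (expR (- (d * `|y|)))%:E < +oo)%E.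
Proof.
move=> d0; pose f (y : R) := expR (- (d * `|y|)).
have cf : continuous f := @continuous_expR_abs d.
rewrite (@ge0_symfun_integralT _ f)//; last 2 first.
- by move=> y; exact: expR_ge0.
- by move=> y; rewrite /f/= normrN.
rewrite lte_mul_pinfty ?ltry//.
rewrite (_ : [set x | _] = `[0, +oo[%classic); last first.
  by apply/seteqP; split => y /=; rewrite in_itv/= andbT.
have mE := @measurable_exponential_pdf R d.
apply: (@le_lt_trans _ _
    (\int[lebesgue_measure]_(y in [set: R]) (d^-1%:E * (exponential_pdf d y)%:E))%E).
  apply: (@le_trans _ _ (\int[lebesgue_measure]_(y in `[0%R, +oo[)
      (d^-1%:E * (exponential_pdf d y)%:E))%E).
    apply: ge0_le_integral => //.
    - by move=> y _; rewrite lee_fin expR_ge0.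
    - apply: measurable_funTS; apply/measurable_EFinP.
      exact: continuous_measurable_fun.
    - by apply: measurable_funTS; apply/measurable_EFinP; exact: measurable_funM.
    - move=> y; rewrite /= in_itv/= andbT => y0; rewrite exponential_pdfE//.
      by rewrite -EFinM lee_fin mulKf ?gt_eqF// /f ger0_norm// mulNr.
  apply: ge0_subset_integral => //.
    by apply/measurable_EFinP; exact: measurable_funM.
  by move=> y _; rewrite -EFinM lee_fin mulr_ge0 ?invr_ge0 ?exponential_pdf_ge0 ?ltW.
rewrite ge0_integralZl_EFin//.
- by rewrite integral_exponential_pdf// mule1 ltry.
- by move=> y _; rewrite lee_fin exponential_pdf_ge0// ltW.
- exact/measurable_EFinP.
- by rewrite invr_ge0 ltW.
Qed.

(** By Tonelli, the [p]-direction contributes only the length 1 of the unit interval. *)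
Lemma lebesgue2_comb_int_integral (g : R -> R) : (forall y, 0 <= g y) ->
  measurable_fun setT g ->
  (\int[@lebesgue2 R]_(th in @comb_int R) (g th.2)%:E =
   \int[lebesgue_measure]_(y in [set: R]) (g y)%:E)%E.
Proof.
move=> g0 mg; pose A : set (measurableTypeR R) := `]0, 1[%classic.
have mA : measurable A by exact: measurable_itv.
have lA : lebesgue_measure A = 1%E.
  by rewrite lebesgue_measure_itv/= lte_fin ltr01 oppr0 adde0.
have mA1 : measurable_fun setT (\1_A : measurableTypeR R -> R).
  exact: measurable_indic.
transitivity (\int[@lebesgue2 R]_th ((\1_A th.1)%:E * (g th.2)%:E))%E.
  rewrite integral_mkcond; apply: eq_integral => th _.
  rewrite patchE indicE comb_intE; have [th1|th1] := boolP (th.1 \in A).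
    by rewrite mul1e ifT// inE; split => //; move: th1; rewrite inE.
  rewrite mul0e ifF//; apply/negP; rewrite inE => -[th1' _].
  by move/negP: th1; apply; rewrite inE.
rewrite /lebesgue2 fubini_tonelli1; last 2 first.
- apply: emeasurable_funM; apply/measurable_EFinP.
    exact: (measurableT_comp mA1 measurable_fst).
  exact: (measurableT_comp mg measurable_snd).
- by move=> th; rewrite mule_ge0 ?lee_fin.
transitivity (\int[lebesgue_measure]_x ((\1_A x)%:E *
    \int[lebesgue_measure]_(y in [set: R]) (g y)%:E))%E.
  apply: eq_integral => x _; rewrite /fubini_F/=.
  rewrite ge0_integralZl_EFin//.
  - by move=> y _; rewrite lee_fin.
  - exact/measurable_EFinP.
rewrite ge0_integralZr//.
- rewrite integral_indic// setIT.
  by rewrite [X in (X * _)%E](_ : _ = 1%E) ?mul1e.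
- exact/measurable_EFinP.
- by apply: integral_ge0 => y _; rewrite lee_fin.
Qed.

Lemma lebesgue2_comb_int_gt0 : (0 < @lebesgue2 R (@comb_int R))%E.
Proof.
rewrite comb_intE (_ : lebesgue2 _ = +oo%E)//.
transitivity (@lebesgue_measure R `]0%R, 1%R[%classic *
    @lebesgue_measure R [set: R])%E.
  by apply: product_measure1E => //; exact: measurable_itv.
rewrite -set_itvNyy !lebesgue_measure_itv/= lte_fin ltr01.
by rewrite oppr0 adde0 mul1e.
Qed.

Context (m : nat) (m_gt1 : (1 < m)%N).

(* The samples 0, 1 and m: their points (k, log (k! (m - k)!)) are not
   collinear, so the kernel decays in every direction of the plane with
   coordinates (logit p, nu). *)
Let sample : {ffun 'I_3 -> 'I_m.+1} := [ffun i : 'I_3 => inord (nth m [:: 0; 1] i)%N].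
Let hyp : R * R * R := comb_update (0, 0, 0) sample.

Let ln_m_gt0 : 0 < ln m%:R :> R.
Proof. by rewrite ln_gt0// ltr1n. Qed.

Lemma comb_prior_kernel_le (th : param_plane R) : comb_int th ->
  comb_prior_kernel m hyp th <= expR (- (ln m%:R * `|th.2|)).
Proof.
move=> th01; rewrite /hyp -comb_prior_kernel_update//.
have -> : comb_prior_kernel m (0, 0, 0) th = 1.
  by rewrite /comb_prior_kernel/= !mul0r !subr0 expR0.
have th01' : 0 <= th.1 <= 1 by case/andP: th01 => /ltW-> /ltW->.
pose al (k : 'I_m.+1) := k%:R * logit th.1 - th.2 * comb_logfact k
   - comb_logZ m th.1 th.2.
(* [al k] is the logarithm of a probability; its sign at [k = 0, 1, m] supplies the hypotheses of
   [three_point_bound]. *)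
have al_le0 k : al k <= 0.
  by rewrite -expR_le1 -comb_pmf_finE// comb_pmf_fin_le1.
rewrite mulr1 /comb_likelihood /= !big_ord_recl big_ord0 mulr1 !ffunE/=.
rewrite !comb_pmf_finE// -/(al _) -/(al _) -/(al _) -!expRD ler_expR.
have := al_le0 (inord 0); have := al_le0 (inord 1); have := al_le0 (inord m).
rewrite /al /comb_logfact !inordK ?ltnS ?(ltnW m_gt1)//.
rewrite subn0 subnn fact0 mul1n muln1 subn1 (_ : 1`! = 1)%N// mul1n.
(* This gives [ln m! = D + l] with [D = ln m] and [l = ln (m - 1)!], the shape required by
   [three_point_bound]; the decay rate [ln m] is this [D]. *)
have -> : m`! = (m * m.-1`!)%N by case: m m_gt1 => // m' _; rewrite factS.
rewrite natrM lnM ?posrE ?ltr0n ?fact_gt0 ?(ltnW m_gt1)//.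
move=> am a1 a0; rewrite mul1r mul0r sub0r in a0 a1 *.
by apply: three_point_bound => //; rewrite ltr1n.
Qed.

Lemma comb_proper_lebesgue : comb_proper m (@lebesgue2 R) !=set0.
Proof.
exists hyp; apply/andP; split.
  exact/comb_prior_kernel_integral_gt0/lebesgue2_comb_int_gt0.
pose g (y : R) := expR (- (ln m%:R * `|y|)).
have mg : measurable_fun setT g.
  by apply: continuous_measurable_fun; exact: continuous_expR_abs.
have g0 y : 0 <= g y by exact: expR_ge0.
apply: le_lt_trans (integral_expR_abs_lty ln_m_gt0).
rewrite -(lebesgue2_comb_int_integral g0 mg).
apply: ge0_le_integral => //.
- exact: measurable_comb_int.
- by move=> th _; rewrite lee_fin ltW// comb_prior_kernel_gt0.
- exact: measurable_comb_prior_kernelE.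
- apply: measurable_funTS; apply/measurable_EFinP.
  exact: (@measurableT_comp _ _ _ _ _ _ g).
- by move=> th th01; rewrite lee_fin; exact: comb_prior_kernel_le.
Qed.

End Lebesgue_prior.

Theorem mainTheorem3 (R : realType) (m n : nat) :
  (* The likelihood is proportional to the kernel; at the boundary of the
     parameter region, where logit p or nu is infinite, the right-hand side
     is to be read as a limit from the interior. *)
  (exists c : R -> R -> R,
    (forall p nu : R, 0 < p < 1 -> 0 < c p nu /\
       forall k : {ffun 'I_n -> 'I_m.+1},
         comb_likelihood p nu%:E k = c p nu * comb_kernel p nu k) /\
    (forall (nu : R) (k : {ffun 'I_n -> 'I_m.+1}),
       (c p nu * comb_kernel p nu k @[p --> 0^'+]
          --> comb_likelihood 0 nu%:E k) /\
       (c p nu * comb_kernel p nu k @[p --> 1^'-]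
          --> comb_likelihood 1 nu%:E k)) /\
    (forall p : R, 0 < p < 1 -> forall k : {ffun 'I_n -> 'I_m.+1},
       (c p nu * comb_kernel p nu k @[nu --> +oo]
          --> comb_likelihood p +oo%E k) /\
       (c p nu * comb_kernel p nu k @[nu --> -oo]
          --> comb_likelihood p -oo%E k)) /\
    (forall p : R, p = 0 \/ p = 1 -> forall k : {ffun 'I_n -> 'I_m.+1},
       (comb_likelihood p nu%:E k @[nu --> +oo]
          --> comb_likelihood p +oo%E k) /\
       (comb_likelihood p nu%:E k @[nu --> -oo]
          --> comb_likelihood p -oo%E k))) /\
  (* (S1, S2) is sufficient, over the whole parameter region. *)
  sufficient_statistic (@comb_par R)
    (fun th => @comb_likelihood R m n th.1 th.2)
    (fun k => (comb_S1 k, comb_S2 k) : R * R) /\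
  (* Exponential family. *)
  exponential_family (@comb_int R)
    (fun th => [tuple logit th.1; - th.2])
    (fun k : 'I_m.+1 => [tuple k%:R; comb_logfact k])
    (fun th => comb_pmf th.1 th.2%:E) /\
  (* Conjugate priors: densities with respect to any reference measure; proper
     ones exist for every finite nonzero measure and, except when nu is not
     identifiable (m <= 1), for Lebesgue measure. *)
  (forall mu : {measure set (param_plane R) -> \bar R},
     conjugate_family mu (@comb_int R)
       (fun th => @comb_likelihood R m n th.1 th.2%:E)
       (comb_proper m mu) (comb_prior m mu)) /\
  (forall mu : {measure set (param_plane R) -> \bar R},
     (0 < mu (@comb_int R) < +oo)%E -> comb_proper m mu !=set0) /\
  ((1 < m)%N -> comb_proper m (@lebesgue2 R) !=set0).
Proof.
split; first exact: comb_likelihood_proportional.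
split; first exact: comb_sufficient_statistic.
split; first exact: comb_exponential_family.
split; first exact: comb_conjugate_family.
split; first exact: comb_proper_finite.
exact: comb_proper_lebesgue.
Qed.
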